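(* $(R,\blacktriangleright)$ is a pre-Lie algebra.
   Context: $\mathfrak{L}$ is a finite set, $\mathbb{N}_0=\{0,1,\dots\}$. $M(\mathfrak{L}\times\mathbb{N}_0)$ is the set of finitely supported functions $\beta:\mathfrak{L}\times\mathbb{N}_0\to\mathbb{N}_0$; $\mathsf{z}^\beta=\prod\mathsf{z}_{(\mathfrak{l},k)}^{\beta(\mathfrak{l},k)}$ are monomials in commuting variables; $[\beta]=\sum_{(\mathfrak{l},k)}(1-k)\beta(\mathfrak{l},k)$; $\mathcal{T}=\{\beta:[\beta]=1\}$; $D=\sum_{(\mathfrak{l},k)}(k+1)\mathsf{z}_{(\mathfrak{l},k+1)}\partial_{\mathsf{z}_{(\mathfrak{l},k)}}$. For a linear endomorphism $\phi$ of the polynomial algebra, $\phi_{\beta}^{\gamma}$ is defined by $\phi\,\mathsf{z}^\gamma=\sum_\beta\phi_\beta^\gamma\mathsf{z}^\beta$. $R$ is the vector space with basis the symbols $\mathsf{r}^{(\gamma,\mathfrak{l})}$, $(\gamma,\mathfrak{l})\in\mathcal{T}\times\mathfrak{L}$, and $\blacktriangleright:R\times R\to R$ is the bilinear map $$\mathsf{r}^{(\gamma,\mathfrak{l})}\blacktriangleright\mathsf{r}^{(\gamma',\mathfrak{l}')}=\sum_{\beta'}\Big(\sum_{k\in\mathbb{N}_0}\big(\tfrac1{k!}D^k\mathsf{z}^\gamma\big)\partial_{\mathsf{z}_{(\mathfrak{l},k)}}\Big)_{\beta'}^{\gamma'}\mathsf{r}^{(\beta',\mathfrak{l}')}.$$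 Pre-Lie means $a\triangleright(b\triangleright c)-(a\triangleright b)\triangleright c=b\triangleright(a\triangleright c)-(b\triangleright a)\triangleright c$ for all $a,b,c$. *)

(* Defs.v *)
From HB Require Import structures.
From mathcomp Require Import all_boot all_order all_algebra.
From mathcomp Require Import finmap ring.
From mathcomp.multinomials Require Import monalg.

Set Implicit Arguments.
Unset Strict Implicit.
Unset Printing Implicit Defensive.

Import GRing.Theory.
Local Open Scope fset_scope.
Local Open Scope ring_scope.

Definition is_prelie (K : comNzRingType) (V : lmodType K) (mu : V -> V -> V) :
    Prop :=
  bilinear_for *:%R *:%R mu /\
  forall a b c : V,
    mu a (mu b c) - mu (mu a b) c = mu b (mu a c) - mu (mu b a) c.

(* Linear extension of a map defined on the basis [<< g >>] of [{malg K[G]}]. *)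
Definition linext (K : nzRingType) (G : choiceType) (V : lmodType K)
    (f : G -> V) (p : {malg K[G]}) : V :=
  \sum_(g <- msupp p) p@_g *: f g.

Section LinExt.
Variables (K : nzRingType) (G : choiceType) (V : lmodType K) (f : G -> V).

Lemma linextEw (d : {fset G}) (p : {malg K[G]}) : msupp p `<=` d ->
  linext f p = \sum_(g <- d) p@_g *: f g.
Proof.
move=> le; rewrite /linext; apply: big_fset_incl => // g _ /mcoeff_outdom ->.
by rewrite scale0r.
Qed.

Lemma linext_is_linear : linear (linext f).
Proof.
move=> c p q.
have le : msupp (c *: p + q) `<=` msupp p `|` msupp q.
  apply: fsubset_trans (msuppD_le _ _) _.
  by apply: fsetSU; exact: msuppZ_le.
rewrite (linextEw le) (linextEw (fsubsetUl _ (msupp q))).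
rewrite (linextEw (fsubsetUr (msupp p) _)) scaler_sumr -big_split /=.
by apply: eq_bigr => g _; rewrite mcoeffD mcoeffZ scalerDl scalerA.
Qed.

HB.instance Definition _ :=
  GRing.isLinear.Build K {malg K[G]} V *:%R (linext f) linext_is_linear.

Lemma linextU g : linext f << g >> = f g.
Proof. by rewrite /linext msuppU oner_eq0 big_seq_fset1 mcoeffUU scale1r. Qed.

End LinExt.

Notation midx L := {cmonom (L * nat)%type}.
Notation mpol K L := {malg K[midx L]}.

Definition bracket (L : finType) (b : midx L) : int :=
  \sum_(x <- finsupp b) (1 - (x.2)%:Z) * (b x)%:Z.

Notation populated L := {b : midx L | bracket b == 1}.

Section Operators.
Variables (K : fieldType) (L : finType).
Implicit Types (p : mpol K L) (b g : midx L).

Definition zvar (x : L * nat) : mpol K L := << ucm x >>.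

(* [divcm] truncates: the monomial is junk when [m x = 0], but then it is
   multiplied by 0. *)
Definition pd (x : L * nat) : mpol K L -> mpol K L :=
  linext (fun m : midx L => (m x)%:R *: << divcm m (ucm x) >>).
HB.instance Definition _ x := GRing.Linear.on (pd x).

(* Strict upper bound on the [k] such that some [z_(l,k)] occurs in [p]; it
   makes the infinite sums over variables finite (see [DopEw], [vfEw]). *)
Definition height p : nat :=
  \max_(m <- msupp p) \max_(x <- finsupp m) x.2.+1.

Definition Dop p : mpol K L :=
  \sum_(l : L) \sum_(k < height p) (k.+1)%:R *: (zvar (l, k.+1) * pd (l, k : nat) p).

Definition vf g (l : L) p : mpol K L :=
  \sum_(k < height p) ((k`!)%:R^-1 *: iter k Dop << g >>) * pd (l, k : nat) p.

Lemma heightP p (m : midx L) (x : L * nat) :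
  m \in msupp p -> (height p <= x.2)%N -> m x = 0%N.
Proof.
move=> mp le; apply/eqP; rewrite cmE_eq0; apply/negP => xm.
have : (x.2.+1 <= height p)%N.
  pose F (m : midx L) := \max_(y <- finsupp m) y.2.+1.
  apply: (@leq_trans (F m)); last exact: (leq_bigmax_seq (F := F) m mp isT).
  exact: (leq_bigmax_seq (F := fun y : L * nat => y.2.+1) x xm isT).
by rewrite ltnNge le.
Qed.

Lemma pd_height l k p : (height p <= k)%N -> pd (l, k) p = 0.
Proof.
move=> le; rewrite /pd /linext big_seq big1 // => m mp.
by rewrite (heightP (x := (l, k)) mp) // scale0r scaler0.
Qed.

Lemma DopEw n p : (height p <= n)%N -> Dop p =
  \sum_(l : L) \sum_(k < n) (k.+1)%:R *: (zvar (l, k.+1) * pd (l, k : nat) p).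
Proof.
move=> le; apply: eq_bigr => l _.
rewrite (big_ord_widen n (fun k => k.+1%:R *: (zvar (l, k.+1) * pd (l, k) p))) //.
rewrite [RHS](bigID (fun k : 'I_n => (k < height p)%N)) /=.
rewrite [X in _ = _ + X]big1 ?addr0 // => k; rewrite -leqNgt => lek.
by rewrite pd_height // mulr0 scaler0.
Qed.

Lemma vfEw n g l p : (height p <= n)%N -> vf g l p =
  \sum_(k < n) ((k`!)%:R^-1 *: iter k Dop << g >>) * pd (l, k : nat) p.
Proof.
move=> le; rewrite /vf.
rewrite (big_ord_widen n
  (fun k => ((k`!)%:R^-1 *: iter k Dop << g >>) * pd (l, k) p)) //.
rewrite [RHS](bigID (fun k : 'I_n => (k < height p)%N)) /=.
rewrite [X in _ = _ + X]big1 ?addr0 // => k; rewrite -leqNgt => lek.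
by rewrite pd_height // mulr0.
Qed.

Lemma Dop_is_linear : linear Dop.
Proof.
move=> c p q; set n := maxn (height (c *: p + q)) (maxn (height p) (height q)).
rewrite !(@DopEw n) ?leq_max ?leqnn ?orbT //.
rewrite scaler_sumr -big_split /=; apply: eq_bigr => l _.
rewrite scaler_sumr -big_split /=; apply: eq_bigr => k _.
by rewrite linearP mulrDr scalerDr -scalerAr !scalerA (mulrC c).
Qed.

HB.instance Definition _ :=
  GRing.isLinear.Build K (mpol K L) (mpol K L) *:%R Dop Dop_is_linear.

Lemma vf_is_linear g l : linear (vf g l).
Proof.
move=> c p q; set n := maxn (height (c *: p + q)) (maxn (height p) (height q)).
rewrite !(@vfEw n) ?leq_max ?leqnn ?orbT //.
rewrite scaler_sumr -big_split /=; apply: eq_bigr => k _.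
by rewrite linearP mulrDr -!scalerAr.
Qed.

HB.instance Definition _ g l :=
  GRing.isLinear.Build K (mpol K L) (mpol K L) *:%R (vf g l) (vf_is_linear g l).

Definition entry (phi : {linear mpol K L -> mpol K L}) b g : K :=
  (phi << g >>)@_b.

(* [vf] preserves the bracket, so the sum over populated indices in [tri_basis]
   below loses no term. *)

Definition homog (n : int) p : Prop :=
  forall m, m \in msupp p -> bracket m = n.

Lemma bracketEw (d : {fset (L * nat)}) b : finsupp b `<=` d ->
  bracket b = \sum_(x <- d) (1 - (x.2)%:Z) * (b x)%:Z.
Proof.
move=> le; rewrite /bracket; apply: big_fset_incl => // x _.
by rewrite -cmE_eq0 => /eqP ->; rewrite mulr0.
Qed.

Lemma bracketM (b g : midx L) : bracket (mmul b g) = bracket b + bracket g.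
Proof.
rewrite (bracketEw (d := finsupp b `|` finsupp g)) ?mdomD //.
rewrite (bracketEw (fsubsetUl _ (finsupp g))).
rewrite (bracketEw (fsubsetUr (finsupp b) _)) -big_split /=.
by apply: eq_bigr => x _; rewrite cmM PoszD mulrDr.
Qed.

Lemma bracketU (x : L * nat) : bracket (ucm x) = 1 - (x.2)%:Z.
Proof. by rewrite /bracket mdomU big_seq_fset1 cmUU mulr1. Qed.

Lemma homog0 n : homog n 0.
Proof. by move=> m; rewrite msupp0. Qed.

Lemma homogD n p q : homog n p -> homog n q -> homog n (p + q).
Proof.
move=> hp hq m /(fsubsetP (msuppD_le _ _)); rewrite in_fsetU => /orP[].
  exact: hp.
exact: hq.
Qed.

Lemma homogZ n c p : homog n p -> homog n (c *: p).
Proof. by move=> hp m /(fsubsetP (msuppZ_le _ _)); exact: hp. Qed.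

Lemma homog_sum n I (r : seq I) (P : pred I) (F : I -> mpol K L) :
  (forall i, P i -> homog n (F i)) -> homog n (\sum_(i <- r | P i) F i).
Proof.
move=> h; apply: (big_ind (homog n)) => //; [exact: homog0 | exact: homogD].
Qed.

Lemma homogU b : homog (bracket b) << b >>.
Proof. by move=> m; rewrite msuppU oner_eq0 in_fset1 => /eqP ->. Qed.

Lemma homogM n1 n2 p q : homog n1 p -> homog n2 q -> homog (n1 + n2) (p * q).
Proof.
move=> hp hq m /(msuppM_le) [b [g [bp gq ->]]].
by rewrite bracketM (hp _ bp) (hq _ gq).
Qed.

Lemma homog_pd n x p : homog n p -> homog (n - (1 - (x.2)%:Z)) (pd x p).
Proof.
move=> hp; rewrite /pd /linext big_seq; apply: homog_sum => m mp.
apply: homogZ; have [->|mx] := eqVneq (m x) 0%N.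
  by rewrite scale0r; exact: homog0.
apply: homogZ; suff -> : n - (1 - (x.2)%:Z) = bracket (divcm m (ucm x)).
  exact: homogU.
rewrite -(hp _ mp) -bracketU.
have {1}-> : m = mmul (divcm m (ucm x)) (ucm x).
  apply/eqP/cmP => y; rewrite cmM divcmE ucmE.
  by case: eqP => [<-|_] /=; rewrite ?subn0 ?addn0 // subnK // lt0n.
by rewrite bracketM addrK.
Qed.

Lemma homog_Dop n p : homog n p -> homog (n - 1) (Dop p).
Proof.
move=> hp; apply: homog_sum => l _; apply: homog_sum => k _; apply: homogZ.
have -> : n - 1 = bracket (ucm (l, k.+1)) + (n - (1 - ((l, k : nat).2)%:Z)).
  by rewrite bracketU /= -addn1 PoszD; ring.
apply: homogM; [exact: homogU | exact: homog_pd].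
Qed.

Lemma homog_vf n g l p : bracket g = 1 -> homog n p -> homog n (vf g l p).
Proof.
move=> hg hp; apply: homog_sum => k _.
have -> : n = (1 - k%:Z) + (n - (1 - ((l, k : nat).2)%:Z)) by rewrite addrC subrK.
apply: homogM (homog_pd hp); apply: homogZ.
elim: (k : nat) => [|j IH] /=.
  by rewrite subr0 -hg; exact: homogU.
have -> : 1 - (j.+1)%:Z = (1 - j%:Z) - 1 by rewrite -addn1 PoszD opprD addrA.
exact: homog_Dop.
Qed.

End Operators.

(* The symbol r^(g, l) is [<< (g, l) >>]. *)
Notation popmod K L := {malg K[(populated L * L)%type]}.

Section Insertion.
Variables (K : fieldType) (L : finType).

Definition tri_basis (u v : populated L * L) : popmod K L :=
  let phi := vf (K := K) (val u.1) u.2 in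
  \sum_(b <- pmap insub (msupp (phi << val v.1 >>)))
    entry phi (val b) (val v.1) *: << (b, v.2) >>.

Definition tri (a c : popmod K L) : popmod K L :=
  linext (fun u => linext (fun v => tri_basis u v) c) a.

Lemma vf_populated (g g' : populated L) (l : L) (b : midx L) :
  entry (vf (K := K) (val g) l) b (val g') != 0 -> bracket b == 1.
Proof.
rewrite /entry mcoeff_neq0 => hb; apply/eqP.
apply: (homog_vf (n := 1)) hb; first exact/eqP/(valP g).
by move=> m; rewrite msuppU oner_eq0 in_fset1 => /eqP ->; apply/eqP/(valP g').
Qed.

Lemma tri_basisE (u v : populated L * L) (b : populated L) (l : L) :
  (tri_basis u v)@_(b, l) =
    entry (vf (K := K) (val u.1) u.2) (val b) (val v.1) *+ (v.2 == l).
Proof.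
rewrite /tri_basis raddf_sum /=; set phi := vf _ _.
set s := pmap _ _.
have Us : uniq s by apply: pmap_sub_uniq; exact: fset_uniq.
under eq_bigr => c _ do rewrite mcoeffZ mcoeffU xpair_eqE.
have [_|nl] := eqVneq v.2 l; last first.
  by rewrite big1 // => c _; rewrite andbF mulr0.
have [bs|bs] := boolP (b \in s); last first.
  rewrite big_seq big1 ?mulr1n => [|c cs]; last first.
    by case: eqVneq => [eq_cb|_]; [rewrite -eq_cb cs in bs | rewrite mulr0].
  by apply/esym/eqP; rewrite /entry mcoeff_eq0; rewrite mem_pmap_sub in bs.
rewrite (bigD1_seq b) //= eqxx mulr1 big1 ?addr0 // => c /negPf ->.
by rewrite mulr0.
Qed.

End Insertion.

(* Main.v *)
From HB Require Import structures.
Require Import Defs.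
From mathcomp Require Import all_boot all_order all_algebra.
From mathcomp Require Import finmap.
From mathcomp.multinomials Require Import monalg.
From mathcomp Require Import ring.

(** Regard an element [a] of R as the family of polynomials
    [P_l := sum_g a_(g, l) z^g], one for each letter [l] ([component l a]), and
    attach to it the vector field
      [X_a := sum_l sum_k (D^k P_l / k!) d/dz_(l, k)]   ([field a]).
    Since it preserves the bracket, [X_a] acts on such families componentwise,
    and this action is exactly the product of R: the [l]-th component of
    [a |> c] is [X_a] applied to that of [c] ([component_tri]).  Hence the
    pre-Lie identity amounts to
      [ [X_a, X_b] = X_(a |> b) - X_(b |> a) ]   ([field_bracket]).

    Both sides are derivations of the polynomial algebra, and both commute
    with [D]: the coefficients [D^k P / k!] of [X_a] are precisely what makes
    [X_a (D z_(l, k)) = D (X_a z_(l, k))], because [D z_(l, k)] is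
    [(k + 1) z_(l, k + 1)] ([field_Dop]).  In characteristic zero, the variables
    [z_(l, k)] are obtained from [z_(l, 0)] by iterating [D] and dividing, so a
    derivation commuting with [D] is determined by its values at the [z_(l, 0)]
    ([derivation_commD_eq0]).  As [X_a z_(l, 0)] is the [l]-th component of [a],
    the two sides agree at [z_(l, 0)] by the description of the product
    above. *)

Set Implicit Arguments.
Unset Strict Implicit.
Unset Printing Implicit Defensive.

Import GRing.Theory.
Local Open Scope ring_scope.

Lemma subr_swap (V : zmodType) (x y z t : V) : x - y = z - t -> x - z = y - t.
Proof.
move/eqP; rewrite subr_eq => /eqP ->.
by rewrite addrAC [z - t]addrC addrK addrC.
Qed.

(** * Derivations of a commutative ring *)

Definition leibniz (A : comNzRingType) (d : A -> A) : Prop :=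
  forall p q, d (p * q) = d p * q + p * d q.

Lemma leibniz1 (A : comNzRingType) (d : A -> A) : leibniz d -> d 1 = 0.
Proof.
move=> hd; have := hd 1 1; rewrite !mulr1 mul1r => /eqP.
by rewrite -subr_eq subrr eq_sym => /eqP.
Qed.

Lemma leibnizM_eq0 (A : comNzRingType) (d : A -> A) p q :
  leibniz d -> d p = 0 -> d q = 0 -> d (p * q) = 0.
Proof. by move=> hd dp dq; rewrite hd dp dq mul0r mulr0 addr0. Qed.

Lemma leibniz_sum (A : comNzRingType) (I : Type) (r : seq I) (d : I -> A -> A) :
  (forall i, leibniz (d i)) -> leibniz (fun p => \sum_(i <- r) d i p).
Proof.
move=> hd p q; rewrite mulr_suml mulr_sumr -big_split /=.
by apply: eq_bigr => i _; rewrite hd.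
Qed.

Lemma leibnizMl (A : comNzRingType) (c : A) (d : A -> A) :
  leibniz d -> leibniz (fun p => c * d p).
Proof. by move=> hd p q; rewrite hd; ring. Qed.

Lemma leibnizZ (K : comNzRingType) (A : comAlgType K) (c : K) (d : A -> A) :
  leibniz d -> leibniz (fun p => c *: d p).
Proof. by move=> hd p q; rewrite hd scalerDr scalerAl scalerAr. Qed.

Lemma leibnizB (A : comNzRingType) (d e : A -> A) :
  leibniz d -> leibniz e -> leibniz (fun p => d p - e p).
Proof. by move=> hd he p q; rewrite hd he; ring. Qed.

Lemma leibniz_bracket (A : comNzRingType) (d e : {additive A -> A}) :
  leibniz d -> leibniz e -> leibniz (fun p => d (e p) - e (d p)).
Proof.
by move=> hd he p q; rewrite hd he !raddfD /= !hd !he; ring.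
Qed.

Definition commutes_with (A : Type) (D d : A -> A) : Prop :=
  forall p, d (D p) = D (d p).

Lemma commutes_withB (A : zmodType) (D : {additive A -> A}) (d e : A -> A) :
  commutes_with D d -> commutes_with D e ->
  commutes_with D (fun p => d p - e p).
Proof. by move=> hd he p; rewrite hd he raddfB. Qed.

Lemma commutes_with_bracket (A : zmodType) (D : {additive A -> A})
    (d e : A -> A) :
  commutes_with D d -> commutes_with D e ->
  commutes_with D (fun p => d (e p) - e (d p)).
Proof.
by move=> hd he; apply: commutes_withB => p; rewrite !(hd, he).
Qed.

Section LeibnizAt.
Variables (K : comNzRingType) (A : comAlgType K) (d : {linear A -> A}).
Implicit Types (p q : A).

(** The Leibniz rule for a single pair of arguments: both sides are bilinear in
    the pair, so the rule extends from a basis to the whole algebra. *)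
Definition leibniz_at p q : Prop := d (p * q) = d p * q + p * d q.

Lemma leibniz_at0l q : leibniz_at 0 q.
Proof. by rewrite /leibniz_at !(mul0r, linear0) addr0. Qed.

Lemma leibniz_at_linear_l c p p' q :
  leibniz_at p q -> leibniz_at p' q -> leibniz_at (c *: p + p') q.
Proof.
rewrite /leibniz_at => hp hp'; rewrite mulrDl -scalerAl !linearP hp hp'.
by rewrite !mulrDl -!scalerAl scalerDr addrACA.
Qed.

Lemma leibniz_at_sym p q : leibniz_at p q -> leibniz_at q p.
Proof.
by rewrite /leibniz_at mulrC => ->; rewrite addrC !(mulrC q, mulrC p).
Qed.

End LeibnizAt.

(** * Linear maps out of a free module *)

Section FreeModule.
Variables (K : nzRingType) (G : choiceType) (V : lmodType K).

Lemma malgZU (c : K) (g : G) : << c *g g >> = c *: << g >> :> {malg K[G]}.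
Proof. by apply/malgP => k; rewrite mcoeffZ !mcoeffU mulr_natr. Qed.

Lemma malg_lin_ind (P : {malg K[G]} -> Prop) :
    P 0 -> (forall g, P << g >>) ->
    (forall c p q, P p -> P q -> P (c *: p + q)) ->
  forall p, P p.
Proof.
move=> P0 PU PD p; rewrite [p]monalgE.
elim/big_rec: _ => // g q _ Pq; rewrite malgZU; exact: PD.
Qed.

Lemma malg_lin_ext (f h : {linear {malg K[G]} -> V}) :
  (forall g, f << g >> = h << g >>) -> f =1 h.
Proof.
move=> eq_fh; elim/malg_lin_ind => [|//|c p q eqp eqq].
  by rewrite !linear0.
by rewrite !linearP eqp eqq.
Qed.

End FreeModule.

Lemma linext_param_linear (K : comNzRingType) (G : choiceType)
    (U V : lmodType K) (f : G -> U -> V) (a : {malg K[G]}) :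
  (forall g, linear (f g)) -> linear (fun p => linext (f^~ p) a).
Proof.
move=> hf c p q; rewrite /linext scaler_sumr -big_split /=.
apply: eq_bigr => g _.
by rewrite hf scalerDr !scalerA mulrC.
Qed.

(** * The polynomial algebra and its derivation [D] *)

Section Polynomials.
Variables (K : fieldType) (L : finType).
Implicit Types (p q : mpol K L) (m g : midx L).

Lemma malgUM m1 m2 : << mmul m1 m2 >> = << m1 >> * << m2 >> :> mpol K L.
Proof. by rewrite malgM_def fgmulUU mulr1. Qed.

Lemma divcmK m x : m x != 0%N -> mmul (divcm m (ucm x)) (ucm x) = m.
Proof.
move=> mx; apply/eqP/cmP => y; rewrite cmM divcmE ucmE.
by case: eqP => [<-|_] /=; rewrite ?subn0 ?addn0 // subnK // lt0n.
Qed.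

Lemma pdU x m : pd x << m >> = (m x)%:R *: << divcm m (ucm x) >> :> mpol K L.
Proof. exact: linextU. Qed.

(** When the variable [x] does not occur in [m1], dividing [m1] alone by it is
    not the same as dividing [m1 m2]; the coefficient [m1 x = 0] removes both
    monomials in this case. *)
Lemma pd_divcmM x m1 m2 :
  (m1 x)%:R *: << divcm (mmul m1 m2) (ucm x) >>
    = pd x << m1 >> * << m2 >> :> mpol K L.
Proof.
rewrite pdU -scalerAl -malgUM.
have [->|mx] := eqVneq (m1 x) 0%N.
  by move: << divcm _ _ >> << mmul _ _ >> => X Y; rewrite !scale0r.
congr (_ *: << _ >>); apply/eqP/cmP => y; rewrite divcmE !cmM divcmE ucmE.
by case: eqP => [<-|_] /=; rewrite ?subn0 // addnBAC // lt0n.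
Qed.

Lemma leibniz_on_monomials (d : {linear mpol K L -> mpol K L}) :
  (forall m1 m2, leibniz_at d << m1 >> << m2 >>) -> leibniz d.
Proof.
move=> hU p q; suff: leibniz_at d p q by [].
elim/malg_lin_ind: p => [|m1|c p p' hp hp'].
- exact: leibniz_at0l.
- elim/malg_lin_ind: q => [|m2|c q q' hq hq'].
  + exact/leibniz_at_sym/leibniz_at0l.
  + exact: hU.
  + by apply/leibniz_at_sym/leibniz_at_linear_l; exact: leibniz_at_sym.
- exact: leibniz_at_linear_l.
Qed.

Lemma pd_leibniz (x : L * nat) : leibniz (pd (K := K) x).
Proof.
apply: leibniz_on_monomials => m1 m2; rewrite /leibniz_at /=.
rewrite -(malgUM m1 m2); apply: etrans (pdU x _) _.
rewrite cmM natrD scalerDl; congr (_ + _); first exact: pd_divcmM.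
by rewrite mulmC mulrC; exact: pd_divcmM.
Qed.

Lemma pd_zvar (x y : L * nat) : pd x (zvar K y) = if x == y then 1 else 0.
Proof.
rewrite /zvar pdU ucmE eq_sym; have [->|_] := eqVneq; last by rewrite scale0r.
rewrite scale1r (_ : divcm _ _ = mone) //.
by apply/eqP/cmP => z; rewrite divcmE subnn cm1.
Qed.

(** Heights of different polynomials differ, so the Leibniz rule is checked on
    sums cut at a common bound. *)
Lemma Dop_leibniz : leibniz (@Dop K L).
Proof.
move=> p q; set n := maxn (height (p * q)) (maxn (height p) (height q)).
rewrite !(@DopEw _ _ n) ?leq_max ?leqnn ?orbT //.
suff h : leibniz (fun r : mpol K L => \sum_(l : L) \sum_(k < n)
    k.+1%:R *: (zvar K (l, k.+1) * pd (l, k : nat) r)) by exact: h.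
apply: leibniz_sum => l; apply: leibniz_sum => k.
exact/leibnizZ/leibnizMl/pd_leibniz.
Qed.

Lemma vf_leibniz g l : leibniz (@vf K L g l).
Proof.
move=> p q; set n := maxn (height (p * q)) (maxn (height p) (height q)).
rewrite !(@vfEw _ _ n) ?leq_max ?leqnn ?orbT //.
suff h : leibniz (fun r : mpol K L => \sum_(k < n)
    ((k`!)%:R^-1 *: iter k (@Dop K L) << g >>) * pd (l, k : nat) r).
  exact: h.
by apply: leibniz_sum => k; exact/leibnizMl/pd_leibniz.
Qed.

Lemma height_zvar l k : (height (zvar K (l : L, k)) <= k.+1)%N.
Proof.
rewrite /height /zvar msuppU oner_eq0 big_seq_fset1.
by rewrite mdomU big_seq_fset1.
Qed.

Lemma Dop_zvar l k : Dop (zvar K (l : L, k)) = k.+1%:R *: zvar K (l, k.+1).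
Proof.
rewrite (DopEw (height_zvar l k)) (bigD1 l) //= [X in _ + X]big1 ?addr0.
  rewrite big_ord_recr big1 /= => [|i _].
    by rewrite add0r pd_zvar eqxx mulr1.
  rewrite pd_zvar xpair_eqE (ltn_eqF (ltn_ord i)) andbF.
  by rewrite mulr0 scaler0.
move=> l' /negPf nl; apply: big1 => i _.
by rewrite pd_zvar xpair_eqE nl mulr0 scaler0.
Qed.

Lemma vf_zvar g l l' k :
  vf g l (zvar K (l', k))
    = if l == l' then (k`!)%:R^-1 *: iter k (@Dop K L) << g >> else 0.
Proof.
rewrite (vfEw _ _ (height_zvar l' k)) big_ord_recr big1 /= => [|i _].
  rewrite add0r pd_zvar xpair_eqE eqxx andbT.
  by case: (l == l'); rewrite (mulr1, mulr0).
by rewrite pd_zvar xpair_eqE (ltn_eqF (ltn_ord i)) andbF mulr0.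
Qed.

(** A derivation is determined by its values on the variables, since these
    generate the algebra: induction on the degree of a monomial. *)
Lemma derivation_eq0 (d : {linear mpol K L -> mpol K L}) :
  leibniz d -> (forall x, d (zvar K x) = 0) -> forall p, d p = 0.
Proof.
move=> hd dz; apply: (@malg_lin_ext _ _ _ d \0) => m /=.
have [n] := ubnP (mdeg m); elim: n m => // n IH m.
have [->|] := eqVneq m mone; first by rewrite (leibniz1 hd).
rewrite -mdeg_eq0 mdegE.
have [->|[x xm] _] := fset_0Vmem (finsupp m); first by rewrite big_seq_fset0.
have /divcmK <- : m x != 0%N by rewrite cmE_neq0.
rewrite -mdegE mdegM mdegU addn1 ltnS => le_n.
by rewrite malgUM; apply: (leibnizM_eq0 hd); [exact: IH | exact: dz].
Qed.

Lemma natrS_neq0 (charK0 : [pchar K] =i pred0) n : n.+1%:R != 0 :> K.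
Proof. by move/pcharf0P: charK0 => ->. Qed.

(** Commuting with [D] propagates the vanishing from [z_(l, k)] to
    [D z_(l, k) = (k + 1) z_(l, k + 1)]; characteristic zero allows the division
    by [k + 1]. *)
Lemma derivation_commD_eq0 (charK0 : [pchar K] =i pred0)
    (d : {linear mpol K L -> mpol K L}) :
    leibniz d -> commutes_with (@Dop K L) d ->
    (forall l, d (zvar K (l, 0%N)) = 0) ->
  forall p, d p = 0.
Proof.
move=> hd dD dz; apply: (derivation_eq0 hd); case=> l.
elim=> [|k IH]; first exact: dz.
move: (zvar K (l, k)) (zvar K (l, k.+1)) (Dop_zvar l k) IH => y z Dy dy.
apply/eqP; have /eqP : k.+1%:R *: d z = 0.
  by rewrite -linearZ_LR -Dy dD dy linear0.
by rewrite scaler_eq0 (negPf (natrS_neq0 charK0 k)).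
Qed.

(** The commutator with [D] is a derivation, so the variables suffice; there the
    identity is [(k + 1) / (k + 1)! = 1 / k!], which is why the coefficients of
    the vector field are divided by factorials. *)
Lemma vf_Dop (charK0 : [pchar K] =i pred0) g l :
  commutes_with (@Dop K L) (@vf K L g l).
Proof.
move=> p; apply/eqP; rewrite -subr_eq0; apply/eqP; move: p.
pose d := (@vf K L g l \o @Dop K L) \- (@Dop K L \o @vf K L g l).
apply: (@derivation_eq0 d) => [|[l' k]].
  exact: (leibniz_bracket (@vf_leibniz g l) Dop_leibniz).
have eS : k.+1%:R * (k.+1`!)%:R^-1 = (k`!)%:R^-1 :> K.
  by rewrite factS natrM invfM mulrA divff ?mul1r ?(natrS_neq0 charK0).
rewrite /= Dop_zvar.
have := vf_zvar g l l' k; have := vf_zvar g l l' k.+1; rewrite iterS.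
move: (iter k _ _) (zvar K (l', k)) (zvar K (l', k.+1)) => u z z' hz' hz.
rewrite hz linearZ_LR /= hz'; case: (l == l').
  by rewrite scalerA eS (linearZ_LR (@Dop K L)) /= subrr.
by rewrite scaler0 linear0 subrr.
Qed.

End Polynomials.

(** * The vector field attached to an element of R *)

Section VectorField.
Variables (K : fieldType) (L : finType).
Implicit Types (a b c : popmod K L) (p q : mpol K L).

Definition component (l : L) : popmod K L -> mpol K L :=
  linext (fun u : populated L * L => if u.2 == l then << val u.1 >> else 0).

HB.instance Definition _ l := GRing.Linear.on (component l).

Definition field a p : mpol K L :=
  linext (fun u : populated L * L => vf (val u.1) u.2 p) a.

Lemma field_is_linear a : linear (field a).
Proof. exact/linext_param_linear/(fun u => vf_is_linear _ _). Qed.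

HB.instance Definition _ a :=
  GRing.isLinear.Build K (mpol K L) (mpol K L) *:%R (field a)
    (field_is_linear a).

Lemma mcoeff_component l a (b : populated L) :
  (component l a)@_(val b) = a@_(b, l).
Proof.
rewrite {2}[a]monalgE !raddf_sum /=; apply: eq_bigr => -[g l'] _ /=.
rewrite mcoeffZ mcoeffU xpair_eqE.
case: (l' == l); last by rewrite mcoeff0 mulr0 andbF.
by rewrite mcoeffU val_eqE andbT mulr_natr.
Qed.

Lemma component_inj a b : (forall l, component l a = component l b) -> a = b.
Proof.
by move=> eq_ab; apply/malgP => -[g l]; rewrite -!mcoeff_component eq_ab.
Qed.

Lemma field_zvar0 a l : field a (zvar K (l, 0%N)) = component l a.
Proof.
apply: eq_bigr => u _; rewrite vf_zvar; congr (_ *: _).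
by case: (u.2 == l); rewrite // fact0 invr1 scale1r.
Qed.

Lemma field_leibniz a : leibniz (field a).
Proof. by apply: leibniz_sum => u; exact/leibnizZ/vf_leibniz. Qed.

Lemma field_Dop (charK0 : [pchar K] =i pred0) a :
  commutes_with (@Dop K L) (field a).
Proof.
move=> p; rewrite /field /linext (linear_sum (@Dop K L)); apply: eq_bigr => u _.
by rewrite (linearZ_LR (@Dop K L)) (vf_Dop charK0).
Qed.

(** The vector field maps a populated monomial to a combination of populated
    monomials, so nothing is lost when the product retains only these. *)
Lemma component_tri_basis l (u v : populated L * L) :
  component l (tri_basis K u v)
    = if v.2 == l then vf (val u.1) u.2 << val v.1 >> else 0.
Proof.
apply/malgP => m.
have [mT|mN] := boolP (bracket m == 1).
  rewrite -[m]/(val (exist (fun m => bracket m == 1) m mT : populated L)).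
  rewrite mcoeff_component tri_basisE /entry.
  by case: (v.2 == l); rewrite ?mcoeff0.
(* Neither side has a monomial that is not populated. *)
transitivity (0 : K).
  rewrite /component /linext raddf_sum /= big1 // => w _; rewrite mcoeffZ.
  case: (w.2 == l); last by rewrite mcoeff0 mulr0.
  rewrite mcoeffU; case: eqP => [wm|_]; last by rewrite mulr0.
  by rewrite -wm (valP w.1) in mN.
case: (v.2 == l); last by rewrite mcoeff0.
by apply/esym/eqP; apply: contraNT mN; exact: vf_populated.
Qed.

Lemma tri_linear_r a : linear (tri a).
Proof. by apply: linext_param_linear => u; exact: linext_is_linear. Qed.

HB.instance Definition _ a :=
  GRing.isLinear.Build K (popmod K L) (popmod K L) *:%R (tri a)
    (tri_linear_r a).

(** The product of R is the action of vector fields on families of polynomials,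
    which turns the pre-Lie identity into a statement on commutators. *)
Lemma component_tri l a c : component l (tri a c) = field a (component l c).
Proof.
move: c; apply: (@malg_lin_ext _ _ _ (component l \o tri a)
                               (field a \o component l)) => v /=.
rewrite /tri /field [component l << _ >>]linextU linear_sum.
apply: eq_bigr => u _; rewrite (linearZ_LR (component l)) linextU.
rewrite /= component_tri_basis; congr (_ *: _).
by case: (v.2 == l); rewrite // linear0.
Qed.

Lemma component_triB l a b c d :
  component l (tri a b - tri c d)
    = field a (component l b) - field c (component l d).
Proof.
apply: etrans (linearB (component l) _ _) _.
exact: (f_equal2 (fun p q => p - q) (component_tri l a b)
                                    (component_tri l c d)).
Qed.

(** The difference of the two sides is a derivation commuting with [D], and at
    [z_(l, 0)] it vanishes term by term, because
    [X_u (X_v z_(l, 0)) = X_u (v_l) = (u |> v)_l = X_(u |> v) z_(l, 0)]. *)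
Lemma field_bracket (charK0 : [pchar K] =i pred0) a b p :
  field a (field b p) - field b (field a p)
    = field (tri a b) p - field (tri b a) p.
Proof.
apply/eqP; rewrite -subr_eq0; apply/eqP; move: p.
pose d := ((field a \o field b) \- (field b \o field a))
            \- (field (tri a b) \- field (tri b a)).
apply: (@derivation_commD_eq0 _ _ charK0 d) => [||l].
- apply: leibnizB; last exact/leibnizB/field_leibniz/field_leibniz.
  exact: (leibniz_bracket (@field_leibniz a) (@field_leibniz b)).
- have hD := field_Dop charK0.
  apply: (@commutes_withB _ (@Dop K L)).
    exact: (@commutes_with_bracket _ (@Dop K L) _ _ (hD a) (hD b)).
  exact: (@commutes_withB _ (@Dop K L) _ _ (hD (tri a b)) (hD (tri b a))).
- have fieldM0 u v :
      field u (field v (zvar K (l, 0%N))) = field (tri u v) (zvar K (l, 0%N)).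
    apply/esym/(etrans (field_zvar0 _ l)).
    by rewrite component_tri -field_zvar0.
  apply/eqP; rewrite subr_eq0; apply/eqP.
  exact: (f_equal2 (fun p q => p - q) (fieldM0 a b) (fieldM0 b a)).
Qed.

End VectorField.

Theorem corollary4p5 (K : fieldType) (charK0 : [pchar K] =i pred0)
    (L : finType) :
  is_prelie (@tri K L).
Proof.
split; first by split=> [c|a]; [exact: linext_is_linear | exact: tri_linear_r].
move=> a b c; apply: component_inj => l.
apply: etrans (component_triB _ _ _ _ _) _.
apply: etrans (esym (component_triB _ _ _ _ _)).
apply: subr_swap.
apply: etrans (field_bracket charK0 a b (component l c)).
exact: (f_equal2 (fun p q => field a p - field b q)
                 (component_tri l b c) (component_tri l a c)).
Qed.
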